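(* (i) Let $n\ge 3$ with $n\ne 4,6$, and $q>\frac12$. If $u\in C^{6}(\mathbb{R}^{n})$, $u>0$, is a radially symmetric solution of $\Delta^{3}u=u^{-q}$ in $\mathbb{R}^{n}$ with $\liminf_{|x|\to+\infty}u(x)/|x|^{4}\in(0,+\infty]$, then $$\lim_{|x|\to+\infty}\frac{u(x)}{|x|^{4}}=\frac{1}{8n(n+2)}\lim_{|x|\to+\infty}\Delta^{2}u(x)\in(0,+\infty).$$ (ii) Let $n\ge 2$, $q>0$, and let $u\in C^{6}(\mathbb{R}^{n})$, $u>0$, be a radially symmetric solution of $\Delta^{3}u=u^{-q}$ in $\mathbb{R}^{n}$. (a) If $\lim_{|x|\to+\infty}\Delta^{2}u(x)\in(0,+\infty]$, then $\liminf_{|x|\to+\infty}u(x)/|x|^{4}\in(0,+\infty]$; if moreover $n\ge 3$, $n\ne 4,6$ and $q>\frac12$, then the limit formula in (i) holds. (b) If $\lim_{|x|\to+\infty}\Delta^{2}u(x)=0$, then $\Delta^{2}u<0$ and $\Delta u>0$ in $\mathbb{R}^{n}$, and there is $C>0$ with $u(x)\le C|x|^{2}$ for all $|x|$ sufficiently large. *)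

(* Defs.v *)
From HB Require Import structures.
From mathcomp Require Import all_boot all_order all_algebra.
From mathcomp Require Import all_classical all_reals all_analysis.
Set Implicit Arguments. Unset Strict Implicit. Unset Printing Implicit Defensive.
Import Order.TTheory GRing.Theory Num.Theory.
Import numFieldNormedType.Exports.
Local Open Scope classical_set_scope.
Local Open Scope ring_scope.

Section Defs.
Variables (R : realType) (n : nat).
Local Notation V := 'rV[R]_n.

(* Euclidean norm |x| on R^n (the canonical norm on 'rV is the sup norm). *)
Definition enorm (x : V) : R := Num.sqrt (\sum_(i < n) x ord0 i ^+ 2).

Definition evec (i : 'I_n) : V := delta_mx ord0 i.
Definition partial (i : 'I_n) (f : V -> R) : V -> R := fun x => 'D_(evec i) f x.

Fixpoint Ck (k : nat) (f : V -> R) : Prop :=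
  match k with
  | 0 => continuous f
  | k.+1 => (forall (i : 'I_n) (x : V), derivable f x (evec i)) /\
            (forall i : 'I_n, Ck k (partial i f))
  end.

Definition lap (f : V -> R) : V -> R :=
  fun x => \sum_(i < n) partial i (partial i f) x.
Definition lapn (k : nat) (f : V -> R) : V -> R := iter k lap f.

Definition radial (f : V -> R) : Prop :=
  forall x y : V, enorm x = enorm y -> f x = f y.

Definition lim_at_infty (f : V -> R) (l : \bar R) : Prop :=
  match l with
  | EFin r => forall e : R, 0 < e -> exists M : R, forall x : V,
                M < enorm x -> `|f x - r| < e
  | +oo%E => forall A : R, exists M : R, forall x : V, M < enorm x -> A < f x
  | -oo%E => forall A : R, exists M : R, forall x : V, M < enorm x -> f x < A
  end.

Definition liminf_at_infty (f : V -> R) : \bar R :=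
  ereal_sup [set ereal_inf [set (f x)%:E | x in [set x : V | M < enorm x]]
            | M in [set: R]].

Definition pos_radial_sol (q : R) (u : V -> R) : Prop :=
  [/\ Ck 6 u, (forall x, 0 < u x), radial u &
      forall x, lapn 3 u x = powR (u x) (- q)].

Definition limit_formula (u : V -> R) : Prop :=
  exists L : R, 0 < L /\ lim_at_infty (lapn 2 u) L%:E /\
    lim_at_infty (fun x => u x / enorm x ^+ 4)
      (L / (8 * n%:R * (n%:R + 2)))%:E.

End Defs.

(* Main.v *)
Require Import Defs.
From HB Require Import structures.
From mathcomp Require Import all_boot all_order all_algebra.
From mathcomp Require Import all_classical all_reals all_analysis.
From mathcomp Require Import ring lra.
Import Order.TTheory GRing.Theory Num.Theory.
Import numFieldNormedType.Exports.
Local Open Scope ring_scope.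

(** Restricting [u], [v = lap u] and [w = lap (lap u)] to the first axis gives
    functions of [r] with [(r^(n-1) G')' = r^(n-1) F] for consecutive members
    [G], [F] of the chain [u, v, w, u^-q].  Integrating twice transfers a bound
    [F >= A r^k] into [G >= (A / ((k+2)(k+n)) - e) r^(k+2)], and monotonicity
    gives that [w] is increasing.

    If [w -> 0] then [w < 0], so [v] decreases; [v] stays positive, since
    otherwise [u -> -oo], and [v <= v 0] gives [u <= C r^2].  If [w -> l > 0],
    then [u >= c r^4] eventually.  Conversely, if [u >= c r^4] eventually and
    [4 q > 2], then [w' <= K r^(1-b)] with [b = min (4 q) (5/2) > 2], so [w]
    converges to some finite [L]; [L > 0], as [L <= 0] would give [u <= C r^2];
    and the transfer from above and below yields
    [u / r^4 -> L / (8 n (n + 2))]. *)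

(** * One-variable calculus: the radial Laplacian and transfer of growth *)

Section OneVariable.
Set Implicit Arguments.
Unset Strict Implicit.
Variable R : realType.
Implicit Types (f g df G F : R -> R) (a b r t A B : R) (k m : nat).

Lemma is_derive1_mul f g t a b : is_derive t 1 f a -> is_derive t 1 g b ->
  is_derive t 1 (fun s => f s * g s) (a * g t + f t * b).
Proof.
move=> fa gb; have := is_deriveM fa gb.
by move/is_derive_eq; apply; rewrite /GRing.scale /= addrC (mulrC a).
Qed.

Lemma is_derive1_scale f t a b : is_derive t 1 f a ->
  is_derive t 1 (fun s => b * f s) (b * a).
Proof. by move=> fa; exact: (is_deriveZ b fa). Qed.

Lemma is_derive1_pow k t : is_derive t 1 (fun s : R => s ^+ k) (k%:R * t ^+ k.-1).
Proof.
have := @is_deriveX _ _ (@idfun R) k t 1 1 (is_derive_id _ _).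
rewrite /GRing.scale /= mulr1; congr is_derive.
by apply/funext => s; rewrite fctE.
Qed.

Lemma derive_le f df a b : a <= b ->
  (forall x, a <= x -> is_derive x 1 f (df x)) ->
  (forall x, a < x -> 0 <= df x) -> f a <= f b.
Proof.
rewrite le_eqVlt => /predU1P[->//|ab] fd df0.
have [||c] := @MVT R f df a b ab.
- by move=> x; rewrite in_itv /= => /andP[ax _]; apply/fd/ltW.
- apply: derivable_within_continuous => x; rewrite in_itv /= => /andP[ax _].
  by have [] := fd x ax.
- rewrite in_itv /= => /andP[ac _] E.
  by rewrite -subr_ge0 E mulr_ge0 ?df0// subr_ge0 ltW.
Qed.

(** The sign is only asked for beyond [a]: comparisons start at [r = 0], while the radial equation
    speaks of [r > 0]. *)
Lemma derive_lt f df a b : a < b ->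
  (forall x, a <= x -> is_derive x 1 f (df x)) ->
  (forall x, a < x -> 0 < df x) -> f a < f b.
Proof.
move=> ab fd df0.
have [||c] := @MVT R f df a b ab.
- by move=> x; rewrite in_itv /= => /andP[ax _]; apply/fd/ltW.
- apply: derivable_within_continuous => x; rewrite in_itv /= => /andP[ax _].
  by have [] := fd x ax.
- rewrite in_itv /= => /andP[ac _] E.
  by rewrite -subr_gt0 E mulr_gt0 ?df0// subr_gt0.
Qed.

(* [r * G'' + (n - 1) * G' = r * F]: [F] is the Laplacian of [G] in dimension
   [n = m.+2], in a form which does not divide by [r]. *)
Definition rlap m G F := exists G1 G2,
  [/\ forall r, is_derive r 1 G (G1 r), forall r, is_derive r 1 G1 (G2 r) &
      forall r, 0 < r -> r * G2 r + m.+1%:R * G1 r = r * F r].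

Lemma rlapN m G F : rlap m G F ->
  rlap m (fun r => - G r) (fun r => - F r).
Proof.
move=> [G1 [G2 [h1 h2 h3]]]; exists (fun r => - G1 r), (fun r => - G2 r).
split=> [r|r|r r0]; [exact: is_deriveN|exact: is_deriveN|].
by have := h3 r r0; lra.
Qed.

(** Multiplying the equation by [r ^+ m] turns its left side into the exact derivative of the flux
    [H = r ^+ m.+1 * G1], which is differentiable at 0 as well. *)
Lemma rlap_div m G F : rlap m G F -> exists G1 H dH,
  [/\ forall r, is_derive r 1 G (G1 r), forall r, is_derive r 1 H (dH r),
      forall r, H r = r ^+ m.+1 * G1 r &
      forall r, 0 < r -> dH r = r ^+ m.+1 * F r].
Proof.
move=> [G1 [G2 [h1 h2 h3]]].
exists G1, (fun r => r ^+ m.+1 * G1 r),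
  (fun r => m.+1%:R * r ^+ m * G1 r + r ^+ m.+1 * G2 r).
split=> // r.
  by apply: is_derive1_mul => //; exact: (is_derive1_pow m.+1).
by move=> r0; rewrite exprS -!mulrA mulrCA -[in RHS]mulrCA -h3//; ring.
Qed.

(** The flux vanishes at 0 and increases, so it is positive for [r > 0], and so is [G1]. *)
Lemma rlap_incr m G F : rlap m G F -> (forall r, 0 < r -> 0 < F r) ->
  forall a b, 0 <= a -> a < b -> G a < G b.
Proof.
move=> /rlap_div[G1 [H [dH [h1 h2 h3 h4]]]] F0 a b a0 ab.
apply: (@derive_lt _ G1) => // x ax.
have x0 := le_lt_trans a0 ax.
suff : H 0 < H x.
  by rewrite !h3 expr0n mul0r pmulr_rgt0 // exprn_gt0.
apply: (@derive_lt _ dH) => // y y0.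
by rewrite h4 // mulr_gt0 ?exprn_gt0 ?F0.
Qed.

(* [liminf f r / r^k >= A] as [r -> +oo]. *)
Definition evge f k A := forall B, B < A ->
  exists M, forall r, M < r -> B * r ^+ k <= f r.

Lemma evge_cst f A M : (forall r, M < r -> A <= f r) -> evge f 0 A.
Proof.
by move=> h B BA; exists M => r Mr; rewrite mulr1 (le_trans (ltW BA)) ?h.
Qed.

(** For [D < A], the function [f r - D / k.+1%:R * r ^+ k.+1] is eventually nondecreasing, hence
    bounded below; lowering the coefficient to [B] absorbs that constant. *)
Lemma evge_antiderivative f df k A : (forall r, 0 < r -> is_derive r 1 f (df r)) ->
  evge df k A -> evge f k.+1 (A / k.+1%:R).
Proof.
move=> fd dfA B BA.
have k0 : 0 < k.+1%:R :> R by rewrite ltr0n.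
have BA' : B * k.+1%:R < A by rewrite -ltr_pdivlMr.
have [BD DA] := midf_lt BA'; set D := (_ / 2) in BD DA.
have [M hM] := dfA _ DA.
pose N := Num.max M 0 + 1; pose c := D / k.+1%:R - B.
have c0 : 0 < c by rewrite subr_gt0 ltr_pdivlMr.
have N0 : 0 < N by rewrite ltr_wpDl // le_max lexx orbT.
have MN : M < N by rewrite (le_lt_trans (y := Num.max M 0)) ?ltrDl // le_max lexx.
pose e := f N - D / k.+1%:R * N ^+ k.+1.
(* The last two thresholds give [- e <= c * r <= c * r ^+ k.+1]. *)
exists (Num.max N (Num.max 1 (- e / c))) => r; rewrite !gt_max => /and3P[Nr r1 er].
have : f N - D / k.+1%:R * N ^+ k.+1 <= f r - D / k.+1%:R * r ^+ k.+1.
  apply: (@derive_le (fun r => f r - D / k.+1%:R * r ^+ k.+1)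
           (fun r => df r - D * r ^+ k)); first exact: ltW.
    move=> x Nx; have x0 : 0 < x := lt_le_trans N0 Nx.
    apply: is_deriveB; first exact: fd.
    have := is_derive1_scale (D / k.+1%:R) (is_derive1_pow k.+1 x).
    by move/is_derive_eq; apply; rewrite mulrA divfK // gt_eqF.
  by move=> x Nx; rewrite subr_ge0; apply: hM; apply: lt_trans Nx.
rewrite -/e => efr.
have : - e <= c * r ^+ k.+1.
  apply: (@le_trans _ _ (c * r)); first by rewrite mulrC -ler_pdivrMr // ltW.
  by rewrite ler_pM2l // exprS ler_peMr ?exprn_ege1 ?ltW // (lt_trans _ r1).
rewrite /c mulrBl; move: efr.
move: (D / _ * _) (B * _) (f r) => x y z; lra.
Qed.

(** Integrating the flux divides the coefficient by [k + m.+2]; cancelling [r ^+ m.+1] leaves [G1]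
    of order [k.+1], and the second integration divides by [k.+2]. *)
Lemma rlap_evge m G F k A : rlap m G F -> evge F k A ->
  evge G k.+2 (A / ((k.+2)%:R * (k + m.+2)%:R)).
Proof.
move=> /rlap_div[G1 [H [dH [h1 h2 h3 h4]]]] FA.
have dHA : evge dH (k + m.+1) A.
  move=> B /FA[M hM]; exists (Num.max M 0) => r; rewrite gt_max => /andP[Mr r0].
  by rewrite h4 // exprD mulrA [leRHS]mulrC ler_pM2r ?exprn_gt0 ?hM.
have := @evge_antiderivative H dH (k + m.+1) A (fun r _ => h2 r) dHA.
rewrite -addnS => HA.
have G1A : evge G1 k.+1 (A / (k + m.+2)%:R).
  move=> B /HA[M hM]; exists (Num.max M 0) => r; rewrite gt_max => /andP[Mr r0].
  have := hM r Mr; rewrite h3 addnS -addSn exprD mulrA [leRHS]mulrC.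
  by rewrite ler_pM2r ?exprn_gt0.
have := @evge_antiderivative G G1 k.+1 _ (fun r _ => h1 r) G1A.
by rewrite -mulrA -invfM mulrC mulrC [in X in evge _ _ (_ / X)]mulrC.
Qed.

(** As [b < m.+2], the flux is at most of order [r^(m+2-b)], a positive power that dominates
    constants. Hence [G1] is at most of order [r^(1-b)], which is integrable at infinity because
    [b > 2]. *)
Lemma rlap_bounded m G F C b N : rlap m G F -> 2 < b -> b < m.+2%:R -> 0 <= C ->
  (forall r, N < r -> F r <= C * r `^ (- b)) ->
  exists M K, forall r, M <= r -> G r <= K.
Proof.
move=> /rlap_div[G1 [H [dH [h1 h2 h3 h4]]]] b2 bm C0 FC.
pose M := Num.max N 1 + 1.
have M1 : 1 < M by rewrite /M ltr_pwDr // le_max lexx orbT.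
have M0 : 0 < M by apply: lt_trans M1.
have NM : N < M by rewrite (le_lt_trans (y := Num.max N 1)) ?ltrDl // le_max lexx.
have powD (r : R) x : 0 < r -> forall k, r ^+ k * r `^ x = r `^ (k%:R + x).
  by move=> r0 k; rewrite powRD ?powR_mulrn ?(gt_eqF r0) ?implybT // ltW.
pose p : R := m.+2%:R - b; have p0 : 0 < p by rewrite subr_gt0.
pose K1 := C / p; have K10 : 0 <= K1 by rewrite divr_ge0 // ltW.
have HM r : M <= r -> H r <= `|H M| + K1 * r `^ p.
  move=> Mr.
  have : K1 * M `^ p - H M <= K1 * r `^ p - H r.
    apply: (@derive_le (fun r => K1 * r `^ p - H r)
      (fun r => C * r `^ (p - 1) - dH r) M r Mr) => x Mx.
      have x0 : 0 < x := lt_le_trans M0 Mx.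
      apply: is_deriveB.
      have := is_derive1_scale K1 (is_derive1_powR p x0).
      by move/is_derive_eq; apply; rewrite mulrA divfK // gt_eqF.
    have x0 : 0 < x := lt_trans M0 Mx.
    rewrite subr_ge0 h4 //.
    have -> : p - 1 = m.+1%:R + - b by rewrite /p -[m.+2]addn1 natrD; lra.
    by rewrite -powD // mulrCA ler_pM2l ?exprn_gt0 // FC // (lt_trans NM).
  have := ler_norm (H M); have : 0 <= K1 * M `^ p by rewrite mulr_ge0 ?powR_ge0.
  lra.
(* Since [1 < M], the power [r^p] is at least 1 beyond [M] and absorbs the constant [|H M|]. *)
pose K := `|H M| + K1; have K0 : 0 <= K by rewrite addr_ge0.
have HK r : M <= r -> H r <= K * r `^ p.
  move=> Mr; apply: le_trans (HM r Mr) _; rewrite mulrDl lerD2r ler_peMr //.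
  by rewrite -(powRr0 r) ler_powR ?ltW // (lt_le_trans M1).
have G1K r : M <= r -> G1 r <= K * r `^ (1 - b).
  move=> Mr; have r0 : 0 < r := lt_le_trans M0 Mr.
  rewrite -(@ler_pM2l _ (r ^+ m.+1)) ?exprn_gt0 // -h3 mulrCA powD //.
  have -> : m.+1%:R + (1 - b) = p by rewrite /p -[m.+2]addn1 natrD; lra.
  exact: HK.
(* The second term is the integral of [K * s^(1-b)] over [s >= M]. *)
exists M, (G M + K / (b - 2) * M `^ (2 - b)) => r Mr.
have b20 : 0 < b - 2 by rewrite subr_gt0.
have : - (K / (b - 2)) * M `^ (2 - b) - G M <= - (K / (b - 2)) * r `^ (2 - b) - G r.
  apply: (@derive_le (fun r => - (K / (b - 2)) * r `^ (2 - b) - G r)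
    (fun r => K * r `^ (1 - b) - G1 r) M r Mr) => x Mx.
    have x0 : 0 < x := lt_le_trans M0 Mx.
    apply: is_deriveB.
    have := is_derive1_scale (- (K / (b - 2))) (is_derive1_powR (2 - b) x0).
    move/is_derive_eq; apply; rewrite mulrA.
    have -> : 2 - b - 1 = 1 - b by ring.
    by congr (_ * _); field; rewrite gt_eqF.
  by rewrite subr_ge0 G1K // ltW.
have : 0 <= K / (b - 2) * r `^ (2 - b) by rewrite mulr_ge0 ?powR_ge0 // divr_ge0 // ltW.
lra.
Qed.

End OneVariable.

(** * Radial functions on R^n and their Laplacian *)

Section Radial.
Set Implicit Arguments.
Unset Strict Implicit.
Variable R : realType.

Lemma Ck_add n k (f g : 'rV[R]_n -> R) : Ck k f -> Ck k g -> Ck k (f + g).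
Proof.
elim: k f g => [|k IH] f g /=.
  by move=> cf cg x; apply: continuousD; [exact: cf|exact: cg].
move=> [df pf] [dg pg]; split=> [i x|i]; first exact: derivableD.
have -> : partial i (f + g) = partial i f + partial i g.
  by apply/funext => x; rewrite /partial deriveD.
exact: IH.
Qed.

Lemma Ck_zero n k : Ck k (0 : 'rV[R]_n -> R).
Proof.
elim: k => [|k IH] /=; first by move=> x; exact: cst_continuous.
split=> [i x|i]; first exact: derivable_cst.
have -> // : partial i (0 : 'rV[R]_n -> R) = 0.
by apply/funext => x; rewrite /partial derive_cst.
Qed.

Lemma Ck_lap n k (f : 'rV[R]_n -> R) : Ck k.+2 f -> Ck k (lap f).
Proof.
move=> [_ pf].
have -> : lap f = \sum_(i < n) partial i (partial i f).
  by apply/funext => x; rewrite fct_sumE.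
elim/big_ind : _ => [|g h|i _]; [exact: Ck_zero|exact: Ck_add|].
by have [_] := pf i; apply.
Qed.

(* Partial derivatives only see the restriction to a line, so that radial
   functions can be differentiated by one-variable calculus alone. *)
Lemma is_derive_line n (f : 'rV[R]_n -> R) x v t d :
  is_derive (x + t *: v) v f d <-> is_derive t 1 (fun s => f (x + s *: v)) d.
Proof.
have E : (fun h : R => h^-1 *: ((f \o shift (x + t *: v)) (h *: v) - f (x + t *: v)))
  = (fun h : R => h^-1 *: (((fun s : R => f (x + s *: v)) \o shift t) (h *: 1)
      - f (x + t *: v))).
  apply/funext => h /=; congr (_ *: (f _ - _)).
  by rewrite scalerDl [h%:A]mulr1 addrCA addrC -addrA addrC.
by split=> -[H1 H2]; split; rewrite /derivable /derive ?E -?E in H1 H2 *.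
Qed.


Lemma enorm_ge0 n (x : 'rV[R]_n) : 0 <= enorm x.
Proof. exact: sqrtr_ge0. Qed.

Lemma enorm_sqr n (x : 'rV[R]_n) : enorm x ^+ 2 = \sum_(i < n) x ord0 i ^+ 2.
Proof. by rewrite sqr_sqrtr // sumr_ge0 // => i _; exact: sqr_ge0. Qed.

Lemma enorm_eq0 n (x : 'rV[R]_n) : enorm x = 0 -> x = 0.
Proof.
move=> x0; apply/rowP => i; rewrite mxE; apply/eqP; rewrite -sqrf_eq0; apply/eqP.
apply: (psumr_eq0P (P := predT) (F := fun j => x ord0 j ^+ 2)) => //.
  by move=> j _; exact: sqr_ge0.
by rewrite -enorm_sqr x0 expr0n.
Qed.

Lemma enorm_axis n r (i : 'I_n) : enorm (r *: evec R i) = `|r|.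
Proof.
rewrite /enorm (bigD1 i) //= big1 => [|j /negPf ji].
  by rewrite addr0 !mxE !eqxx mulr1 sqrtr_sqr.
by rewrite !mxE ji andbF mulr0 expr0n.
Qed.

Lemma enorm_shift_sqr n (x : 'rV[R]_n) i t :
  enorm (x + t *: evec R i) ^+ 2 = enorm x ^+ 2 + 2 * t * x ord0 i + t ^+ 2.
Proof.
rewrite !enorm_sqr (bigD1 i) //= [in RHS](bigD1 i) //=.
rewrite (eq_bigr (fun j => x ord0 j ^+ 2)) => [|j /negPf ji]; last first.
  by rewrite !mxE ji andbF mulr0 addr0.
by rewrite !mxE !eqxx mulr1; ring.
Qed.

(** Along the line the norm is the square root of a quadratic in [t] whose value at 0 is
    positive. *)
Lemma is_derive1_enorm_shift n (x : 'rV[R]_n) i : 0 < enorm x ->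
  is_derive (0 : R) 1 (fun t => enorm (x + t *: evec R i)) (x ord0 i / enorm x).
Proof.
move=> x0.
have -> : (fun t => enorm (x + t *: evec R i)) =
  Num.sqrt \o (fun t => enorm x ^+ 2 + (2 * x ord0 i * t + t ^+ 2)).
  apply/funext => t /=; rewrite -[LHS]ger0_norm ?enorm_ge0 // -sqrtr_sqr.
  by rewrite enorm_shift_sqr; congr Num.sqrt; ring.
have S0 : 0 < enorm x ^+ 2 + (2 * x ord0 i * 0 + 0 ^+ 2).
  by rewrite mulr0 expr0n /= !addr0 exprn_gt0.
have dp : is_derive (0 : R) 1
    (fun t => enorm x ^+ 2 + (2 * x ord0 i * t + t ^+ 2)) (2 * x ord0 i).
  have := is_deriveD (is_derive_cst (enorm x ^+ 2) (0 : R) 1)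
    (is_deriveD (is_derive1_scale (2 * x ord0 i) (is_derive_id (0 : R) 1))
       (is_derive1_pow 2 (0 : R))).
  by move/is_derive_eq; apply; rewrite expr1; ring.
have := is_derive1_comp (f := Num.sqrt)
  (g := fun t => enorm x ^+ 2 + (2 * x ord0 i * t + t ^+ 2)) (is_derive1_sqrt S0) dp.
move/is_derive_eq; apply.
rewrite mulr0 expr0n /= !addr0 sqrtr_sqr ger0_norm ?enorm_ge0 //.
by field; rewrite gt_eqF.
Qed.

Section RadialLaplacian.
Variables (m : nat) (f : 'rV[R]_m.+2 -> R).
Variable k : nat.
Hypotheses (f_radial : radial f) (f_Ck : Ck k.+2 f).
Let e0 := evec R (ord0 : 'I_m.+2).
(** The profile lives on the whole axis, negative [r] included, so that it has two-sided derivatives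
    at 0. *)
Let G r := f (r *: e0).
Let G1 r := partial ord0 f (r *: e0).
Let G2 r := partial ord0 (partial ord0 f) (r *: e0).

Lemma radial_profile x : f x = f (enorm x *: e0).
Proof. by apply: f_radial; rewrite enorm_axis ger0_norm ?enorm_ge0. Qed.

Let axis_derive (g : 'rV[R]_m.+2 -> R) (r : R) : derivable g (r *: e0) e0 ->
  is_derive r 1 (fun s => g (s *: e0)) (partial ord0 g (r *: e0)).
Proof.
move=> dg.
have : is_derive (0 + r *: e0) e0 g (partial ord0 g (r *: e0)).
  by rewrite add0r; exact: derivableP.
move/is_derive_line; congr is_derive.
by apply/funext => s; rewrite add0r.
Qed.

Let dG (r : R) : is_derive r 1 G (G1 r).
Proof. by apply: axis_derive; case: f_Ck => + _; exact. Qed.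

Let dG1 (r : R) : is_derive r 1 G1 (G2 r).
Proof.
apply: (@axis_derive (partial ord0 f)).
by case: f_Ck => _ /(_ ord0)[+ _]; exact.
Qed.

(** On the line through [x] in direction [i], [f] is [G] composed with the norm, so the one-variable
    chain rule at [t = 0] suffices. *)
Lemma partial_radial x i : 0 < enorm x ->
  partial i f x = G1 (enorm x) * (x ord0 i / enorm x).
Proof.
move=> x0.
have := is_derive1_comp (f := G) (g := fun t => enorm (x + t *: evec R i)) (x := 0)
  (dG _) (is_derive1_enorm_shift i x0).
have -> : G \o (fun t => enorm (x + t *: evec R i)) =
          fun t => f (x + t *: evec R i).
  by apply/funext => t /=; rewrite /G -radial_profile.
by move/is_derive_line; rewrite scale0r addr0 => -[].
Qed.

Lemma partial2_radial x i : 0 < enorm x ->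
  partial i (partial i f) x = G2 (enorm x) * (x ord0 i / enorm x) ^+ 2
    + G1 (enorm x) * ((enorm x)^-1 - x ord0 i ^+ 2 / enorm x ^+ 3).
Proof.
move=> x0; pose rho t := enorm (x + t *: evec R i).
have drho : is_derive (0 : R) 1 rho (x ord0 i / enorm x) := is_derive1_enorm_shift i x0.
have rho0 : rho 0 = enorm x by rewrite /rho scale0r addr0.
have dlin : is_derive (0 : R) 1 (fun t => x ord0 i + t) 1.
  have := is_deriveD (is_derive_cst (x ord0 i) (0 : R) 1) (is_derive_id (0 : R) 1).
  by move/is_derive_eq; apply; rewrite add0r.
have rn0 : rho 0 != 0 by rewrite rho0 gt_eqF.
have := is_derive1_mul (is_derive1_comp (f := G1) (dG1 _) drho)
  (is_derive1_mul dlin (is_deriveV rn0 drho)).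
move=> D.
have : is_derive (0 : R) 1 (fun t => partial i f (x + t *: evec R i))
   (G2 (enorm x) * (x ord0 i / enorm x) ^+ 2
    + G1 (enorm x) * ((enorm x)^-1 - x ord0 i ^+ 2 / enorm x ^+ 3)).
  (* The first-order formula holds only off the origin, so the two functions of [t] are identified
     only near 0, where [rho] stays positive by continuity. *)
  apply: near_eq_is_derive; last first.
    apply: (is_derive_eq D); rewrite /= rho0 /GRing.scale /=; field.
    by rewrite gt_eqF.
  have crho : {for 0, continuous rho}.
    apply: differentiable_continuous; apply/derivable1_diffP.
    by case: drho.
  have : \forall t \near (0 : R), 0 < rho t.
    have /cvgrPdist_lt /(_ _ x0) := crho; rewrite rho0; apply: filterS => t.
    by rewrite ltr_norml; lra.
  apply: filterS => t t0 /=; rewrite partial_radial //.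
  by rewrite !mxE !eqxx mulr1.
by move/is_derive_line; rewrite scale0r addr0 => -[].
Qed.

(** The squares of the coordinates add up to [enorm x ^+ 2]: in the sum of the second partials, [G2]
    gets coefficient 1 and [G1] gets [(m.+2 - 1) / enorm x]. *)
Lemma lap_radial x : 0 < enorm x ->
  enorm x * lap f x = enorm x * G2 (enorm x) + m.+1%:R * G1 (enorm x).
Proof.
move=> x0; have xn0 : enorm x != 0 by rewrite gt_eqF.
rewrite /lap (eq_bigr _ (fun i _ => partial2_radial i x0)) big_split /=.
rewrite -!mulr_sumr sumrB /=.
under eq_bigr do rewrite expr_div_n.
rewrite -!mulr_suml -enorm_sqr sumr_const card_ord -[_ *+ _]mulr_natl.
have -> : m.+2%:R = m.+1%:R + 1 :> R by rewrite -natr1.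
by field.
Qed.

(** Off the origin [lap_radial] expresses the Laplacian through the norm; the origin is the only
    point of norm 0. *)
Lemma radial_lap : radial (lap f).
Proof.
move=> x y xy; have := enorm_ge0 x; rewrite le_eqVlt => /predU1P[x0|x0].
  by rewrite (enorm_eq0 (esym x0)) (@enorm_eq0 _ y) // -xy.
apply: (@mulfI _ (enorm x)); first by rewrite gt_eqF.
by rewrite {2}xy !lap_radial -?xy.
Qed.

Lemma radial_rlap : rlap m (fun r => f (r *: e0)) (fun r => lap f (r *: e0)).
Proof.
exists G1, G2; split=> // r r0.
have er : enorm (r *: e0) = r by rewrite enorm_axis gtr0_norm.
by have := @lap_radial (r *: e0); rewrite er => <-.
Qed.

End RadialLaplacian.

End Radial.

(** * Growth and limits of the profiles of a solution *)

Section Profile.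
Set Implicit Arguments.
Unset Strict Implicit.
Variable R : realType.

(** Serves to pick one radius beyond several thresholds at once. *)
Lemma exists_gt (s : seq R) : exists r, forall x, x \in s -> x < r.
Proof.
elim: s => [|y s [r hr]]; first by exists 0.
exists (Num.max r (y + 1)) => x; rewrite inE => /predU1P[->|/hr xr].
  by rewrite lt_max ltrDl ltr01 orbT.
by rewrite lt_max xr.
Qed.

Section Solution.
Variables (m : nat) (q : R) (u v w : R -> R).
Hypotheses (u_gt0 : forall r, 0 < u r) (uv : rlap m u v) (vw : rlap m v w).
Hypothesis w_eq : rlap m w (fun r => u r `^ (- q)).

Lemma w_incr a b : 0 <= a -> a < b -> w a < w b.
Proof. by apply: (rlap_incr w_eq) => r _; rewrite powR_gt0. Qed.

(** Here [v] decreases from [v 0], so [- v] is bounded below and the transfer applies to [- u] with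
    [k = 0]. *)
Lemma quadratic_upper_bound : (forall r, 0 <= r -> w r < 0) ->
  exists C M, 0 < C /\ forall r, M < r -> u r <= C * r ^+ 2.
Proof.
move=> w0.
have v0 : forall r, 0 < r -> - v 0 <= - v r.
  move=> r r0; apply/ltW; apply: (rlap_incr (rlapN vw)) => // s s0.
  by rewrite oppr_gt0 w0 // ltW.
have /(rlap_evge (rlapN uv)) := evge_cst v0; set A := _ / _ => hA.
(* This coefficient is below [A], as the transfer demands, and negative, so that its opposite is a
   valid [C]. *)
have BA : Num.min A 0 - 1 < A.
  by rewrite ltrBlDr (le_lt_trans (y := A)) ?ge_min ?lexx // ltrDl.
have [M hM] := hA _ BA; exists (- (Num.min A 0 - 1)), M; split.
  by rewrite oppr_gt0 ltrBlDr add0r (le_lt_trans (y := 0)) // ge_min lexx orbT.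
by move=> r /hM; rewrite mulNr lerNr.
Qed.

(** If [v a <= 0], then [v] stays below the negative number [v (a + 1)] from [a + 1] on. The
    transfer with coefficient 0 already gives [- u >= 0] far out, against [u > 0]. *)
Lemma v_gt0 : (forall r, 0 <= r -> w r < 0) -> forall r, 0 <= r -> 0 < v r.
Proof.
move=> w0 a a0; rewrite ltNge; apply/negP => va.
have vdecr := rlap_incr (rlapN vw).
have {}vdecr x y : 0 <= x -> x < y -> v y < v x.
  move=> x0 xy; rewrite -ltrN2; apply: vdecr => // r r0.
  by rewrite oppr_gt0 w0 // ltW.
have va1 : v (a + 1) < 0 by rewrite (lt_le_trans _ va) ?vdecr ?ltrDl.
have vneg : forall r, a + 1 < r -> - v (a + 1) <= - v r.
  by move=> r ar; rewrite lerN2 ltW // vdecr // addr_ge0.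
have /(rlap_evge (rlapN uv)) /(_ 0)[|M hM] := evge_cst vneg.
  by rewrite divr_gt0 ?oppr_gt0 // mulr_gt0 ?ltr0n.
have := hM (M + 1); rewrite ltrDl mul0r oppr_ge0 => /(_ ltr01).
by rewrite leNgt u_gt0.
Qed.

Lemma quartic_lower_bound c N : 0 < c -> (forall r, N < r -> c <= w r) ->
  exists B M, 0 < B /\ forall r, M < r -> B * r ^+ 4 <= u r.
Proof.
move=> c0 /evge_cst /(rlap_evge vw) /(rlap_evge uv); set A := _ / _ => hA.
have A0 : 0 < A by rewrite !divr_gt0 // mulr_gt0 ?ltr0n.
have [M hM] := hA (A / 2) ltac:(lra); exists (A / 2), M; split=> //.
by rewrite divr_gt0.
Qed.

Lemma quartic_limit L : (forall e, 0 < e -> exists M, forall r, M < r -> `|w r - L| < e) ->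
  forall e, 0 < e -> exists M, forall r, M < r ->
    `|u r / r ^+ 4 - L / (8 * m.+2%:R * (m.+2%:R + 2))| < e.
Proof.
move=> wL e e0; set A := L / _.
(* With [n = m.+2], the transfers from order 0 to 2 and from 2 to 4 divide by [2 n] and [4 (n + 2)],
   in all by [8 n (n + 2)]. *)
have constE : (2%:R * (0 + m.+2)%:R)^-1 / (4%:R * (2 + m.+2)%:R) =
    (8 * m.+2%:R * (m.+2%:R + 2))^-1 :> R.
  by rewrite add0n natrD -invfM; congr _^-1; ring.
have w1 : evge w 0 L.
  move=> B BL; have [|M hM] := wL (L - B); first by rewrite subr_gt0.
  by exists M => r /hM; rewrite ltr_norml mulr1; lra.
(* Since [evge] bounds from below only, upper bounds come from the negated chain. *)
have w2 : evge (fun r => - w r) 0 (- L).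
  move=> B BL; have [|M hM] := wL (- L - B); first by rewrite subr_gt0.
  by exists M => r /hM; rewrite ltr_norml mulr1; lra.
have {w1} := rlap_evge uv (rlap_evge vw w1); rewrite -mulrA constE -/A => u1.
have {w2} := rlap_evge (rlapN uv) (rlap_evge (rlapN vw) w2).
rewrite -mulrA constE mulNr -/A => u2.
have [M1 h1] := u1 (A - e / 2) ltac:(lra).
have [M2 h2] := u2 (- A - e / 2) ltac:(lra).
exists (Num.max 0 (Num.max M1 M2)) => r; rewrite !gt_max => /and3P[r0 r1 r2].
have r4 : 0 < r ^+ 4 by rewrite exprn_gt0.
have := h1 r r1; rewrite -ler_pdivlMr // => k1.
have := h2 r r2; rewrite -ler_pdivlMr // mulNr => k2.
by rewrite ltr_norml; move: (u r / _) k1 k2 => z k1 k2; lra.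
Qed.

(** The natural exponent [4 * q] exceeds 2 but may be too large for [rlap_bounded]; capping it at
    [5 / 2] keeps it below 3 and only weakens the bound, as [r > 1]. *)
Lemma powR_decay c N : 0 < c -> 1 / 2 < q -> (forall r, N < r -> c * r ^+ 4 <= u r) ->
  forall r, Num.max N 1 < r ->
    u r `^ (- q) <= c `^ (- q) * r `^ (- Num.min (4 * q) (5 / 2)).
Proof.
move=> c0 q2 cu r; rewrite gt_max => /andP[Nr r1].
have q0 : 0 < q by lra.
have r0 : 0 < r by lra.
rewrite !powRN -invfM lef_pV2 ?posrE ?mulr_gt0 ?powR_gt0 //.
apply: (@le_trans _ _ ((c * r ^+ 4) `^ q)).
  rewrite powRM ?exprn_ge0 ?(ltW c0) ?(ltW r0) // ler_pM2l ?powR_gt0 //.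
  rewrite -(powR_mulrn 4 (ltW r0)) -powRrM ler_powR ?(ltW r1) //.
  by rewrite ge_min lexx.
apply: ge0_ler_powR; rewrite ?nnegrE ?(ltW q0) ?(ltW (u_gt0 r)) ?cu //.
by rewrite mulr_ge0 ?exprn_ge0 ?ltW.
Qed.

(** [L] is the supremum of [w] over [r >= 0]. It is not attained, by strict monotonicity, so even
    [L = 0] would force [w < 0]. *)
Lemma w_limit K M : (forall r, M <= r -> w r <= K) -> exists L,
  (forall r, 0 <= r -> w r < L) /\
  forall e, 0 < e -> exists M, forall r, M < r -> `|w r - L| < e.
Proof.
move=> wK; pose E := [set w r | r in [set r | 0 <= r]]%classic.
have Eub r : 0 <= r -> w r <= K.
  move=> r0; have [Mr|rM] := leP M r; first exact: wK.
  by rewrite (le_trans (ltW (w_incr r0 rM))) ?wK.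
have supE : has_sup E.
  split; first by exists (w 0), 0 => //=.
  by exists K => _ [r r0 <-]; exact: Eub.
have wle r : 0 <= r -> w r <= sup E.
  by move=> r0; apply: ub_le_sup; [exact: supE.2|exists r].
exists (sup E); split=> [r r0|e e0].
  apply: lt_le_trans (w_incr r0 (_ : r < r + 1)) _; first by rewrite ltrDl.
  by apply: wle; rewrite addr_ge0.
have [_ [r r0 <-] wr] := sup_adherent e0 supE.
exists r => s rs; have := w_incr r0 rs.
have := wle s (le_trans r0 (ltW rs)).
by rewrite ltr_norml; lra.
Qed.

End Solution.

Lemma limit_of_quartic_growth m q (u v w : R -> R) c N :
  (0 < m)%N -> (forall r, 0 < u r) -> rlap m u v -> rlap m v w ->
  rlap m w (fun r => u r `^ (- q)) -> 1 / 2 < q -> 0 < c ->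
  (forall r, N < r -> c * r ^+ 4 <= u r) ->
  exists L, [/\ 0 < L,
    forall e, 0 < e -> exists M, forall r, M < r -> `|w r - L| < e &
    forall e, 0 < e -> exists M, forall r, M < r ->
      `|u r / r ^+ 4 - L / (8 * m.+2%:R * (m.+2%:R + 2))| < e].
Proof.
move=> m0 u0 uv vw wE q2 c0 cu.
have [|||M [K wK]] := rlap_bounded wE _ _ _ (powR_decay u0 c0 q2 cu).
- by rewrite lt_min; apply/andP; split; lra.
(* By [0 < m] the dimension [m.+2] is at least 3, above the cap [5 / 2]. *)
- rewrite (le_lt_trans (y := 5 / 2)) ?ge_min ?lexx ?orbT //.
  by rewrite (lt_le_trans (y := 3%:R)) ?ler_nat ?ltnS //; lra.
- exact: powR_ge0.
have [L [wltL wL]] := w_limit u0 wE wK.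
exists L; split=> //; last first.
  exact (quartic_limit uv vw wL).
rewrite ltNge; apply/negP => L0.
have [|C [M' [C0 uC]]] := quadratic_upper_bound uv vw.
  by move=> r r0; apply: lt_le_trans (wltL r r0) L0.
(* At such [r] both bounds on [u r] hold, yet [C < c * r <= c * r * r] contradicts them. *)
have [r hr] := exists_gt [:: M'; N; 1; C / c].
have r1 : 1 < r by apply: hr; rewrite !inE eqxx ?orbT.
have cr : C < c * r.
  by rewrite mulrC -ltr_pdivrMr //; apply: hr; rewrite !inE eqxx ?orbT.
have r0 : 0 < r by lra.
have : c * r ^+ 4 <= C * r ^+ 2.
  by apply: le_trans (cu r _) (uC r _); apply: hr; rewrite !inE eqxx ?orbT.
rewrite (_ : c * r ^+ 4 = c * r * r * r ^+ 2); last by ring.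
rewrite ler_pM2r ?exprn_gt0 // leNgt => /negP; apply.
by apply: (lt_le_trans cr); rewrite ler_peMr ?ltW // mulr_gt0.
Qed.

End Profile.

(** * From profiles back to solutions on R^n *)

Section RadialSolution.
Set Implicit Arguments.
Unset Strict Implicit.
Variables (R : realType) (m : nat) (q : R) (u : 'rV[R]_m.+2 -> R).
Hypothesis u_sol : pos_radial_sol q u.
Let e0 := evec R (ord0 : 'I_m.+2).
Let g k (r : R) := lapn k u (r *: e0).

(** Each Laplacian spends two of the six derivatives, so [lapn 2 u] is still C^2 and the radial
    equation holds at all three levels. *)
Let lapn_facts k : (k <= 2)%N -> radial (lapn k u) /\ Ck (6 - k.*2) (lapn k u).
Proof.
have [C6 _ urad _] := u_sol.
elim: k => [//|k IH] k2; have [rk Ckk] := IH (ltnW k2).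
have k4 : (6 - k.*2 = (6 - k.+1.*2).+2)%N by case: k k2 {IH rk Ckk} => [|[|]].
rewrite k4 in Ckk; split; last exact: Ck_lap.
exact: radial_lap rk Ckk.
Qed.

Let g_rlap k : (k <= 2)%N -> rlap m (g k) (g k.+1).
Proof.
move=> k2; have [rk Ckk] := lapn_facts k2.
have k4 : (6 - k.*2 = (4 - k.*2).+2)%N by case: k k2 {rk Ckk} => [|[|[|]]].
by rewrite k4 in Ckk; exact: radial_rlap rk Ckk.
Qed.

Let g_radial k x : (k <= 2)%N -> lapn k u x = g k (enorm x).
Proof. by move=> /lapn_facts[rk _]; exact: radial_profile. Qed.

Let u_profile x : u x = g 0 (enorm x).
Proof. exact: (@g_radial 0). Qed.

Let g_gt0 r : 0 < g 0 r.
Proof. by have [_ + _ _] := u_sol; exact. Qed.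

Let g_eq : rlap m (g 2) (fun r => g 0 r `^ (- q)).
Proof.
have := g_rlap (leqnn 2); congr rlap; apply/funext => r.
by have [_ _ _ E] := u_sol; exact: E.
Qed.

Lemma along_axis (P : 'rV[R]_m.+2 -> Prop) M :
  (forall x, M < enorm x -> P x) -> forall r, Num.max M 0 < r -> P (r *: e0).
Proof.
move=> hP r; rewrite gt_max => /andP[Mr r0]; apply: hP.
by rewrite enorm_axis gtr0_norm.
Qed.

Lemma quartic_limit_formula c N : (0 < m)%N -> 1 / 2 < q -> 0 < c ->
  (forall r, N < r -> c * r ^+ 4 <= g 0 r) -> limit_formula u.
Proof.
move=> m0 q2 c0 cg.
have g01 := g_rlap (leq0n 2); have g12 := g_rlap (isT : (1 <= 2)%N).
have [L [L0 wL uL]] := limit_of_quartic_growth m0 g_gt0 g01 g12 g_eq q2 c0 cg.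
exists L; split=> //; split=> e e0'.
  by have [M hM] := wL e e0'; exists M => x /hM; rewrite (g_radial _ (leqnn 2)).
have [M hM] := uL e e0'; exists M => x /hM.
by rewrite u_profile.
Qed.

Lemma liminf_gt0_bound :
  (0 < liminf_at_infty (fun x => (u x / enorm x ^+ 4)%R))%E ->
  exists c N, 0 < c /\ forall r, N < r -> c * r ^+ 4 <= g 0 r.
Proof.
move=> /ereal_sup_gt[_ [M _ <-]] inf0.
have [c c0 cinf] : exists2 c : R, 0 < c & (c%:E <= ereal_inf
    [set (u x / enorm x ^+ 4)%R%:E | x in [set x | (M < enorm x)%R]]%classic)%E.
  (* The infimum may be [+oo]; any positive [c] then works, and 1 is taken. *)
  move: inf0; case: ereal_inf => [r r0|_|//]; first by exists r.
  by exists 1; rewrite ?ltr01 ?leey.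
exists c, (Num.max M 0); split=> // r Mr; have r0 : 0 < r.
  by move: Mr; rewrite gt_max => /andP[].
rewrite -ler_pdivlMr ?exprn_gt0 // -lee_fin.
apply: (le_trans cinf); apply: ereal_inf_lbound; exists (r *: e0) => /=.
  by rewrite enorm_axis gtr0_norm //; move: Mr; rewrite gt_max => /andP[].
by rewrite enorm_axis gtr0_norm.
Qed.

Lemma liminf_gt0 c N : 0 < c -> (forall r, N < r -> c * r ^+ 4 <= g 0 r) ->
  (0 < liminf_at_infty (fun x => (u x / enorm x ^+ 4)%R))%E.
Proof.
move=> c0 cg; apply: (@lt_le_trans _ _ c%:E); first by rewrite lte_fin.
(* The maximum with 0 keeps the origin out, so the division by [enorm x ^+ 4] is genuine. *)
apply: (@le_trans _ _ (ereal_inf [set (u x / enorm x ^+ 4)%:E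
    | x in [set x | Num.max N 0 < enorm x]]%classic)); last first.
  by apply: ereal_sup_ubound; exists (Num.max N 0).
apply: le_ereal_inf_tmp => y [x /=]; rewrite gt_max => /andP[Nx x0] <-.
by rewrite lee_fin ler_pdivlMr ?exprn_gt0 // u_profile cg.
Qed.

Lemma lapn2_lower_bound l : (0 < l)%E -> lim_at_infty (lapn 2 u) l ->
  exists c N, 0 < c /\ forall r, N < r -> c <= g 2 r.
Proof.
case: l => [l||//] l0 ulim.
  have l20 : 0 < l / 2 by rewrite divr_gt0.
  have [M hM] := ulim _ l20; exists (l / 2), (Num.max M 0); split=> // r.
  by move/(along_axis hM); rewrite ltr_norml /g; lra.
have [M hM] := ulim 1; exists 1, (Num.max M 0); split=> // r.
by move/(along_axis hM)/ltW.
Qed.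

(** A strictly increasing function with limit 0 is negative: if [g 2 r >= 0], then [g 2] stays above
    the positive number [g 2 (r + 1)] beyond [r + 1]. *)
Lemma lapn2_neg : lim_at_infty (lapn 2 u) 0%:E -> forall r, 0 <= r -> g 2 r < 0.
Proof.
move=> wlim r r0; rewrite ltNge; apply/negP => wr.
have incr := w_incr g_gt0 g_eq.
have r1 : r < r + 1 by rewrite ltrDl.
have e0' : 0 < g 2 (r + 1) := le_lt_trans wr (incr _ _ r0 r1).
have [M hM] := wlim _ e0'.
have [s hs] := exists_gt [:: Num.max M 0; r + 1].
have s1 : r + 1 < s by apply: hs; rewrite !inE eqxx orbT.
have := incr (r + 1) s (addr_ge0 r0 ler01) s1.
have /(along_axis hM) : Num.max M 0 < s by apply: hs; rewrite !inE eqxx.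
rewrite subr0 => /(le_lt_trans (ler_norm _)) h1 h2.
by have := lt_trans h1 h2; rewrite ltxx.
Qed.

Lemma quartic_liminf l : (0 < l)%E -> lim_at_infty (lapn 2 u) l ->
  (0 < liminf_at_infty (fun x => (u x / enorm x ^+ 4)%R))%E.
Proof.
move=> l0 /(lapn2_lower_bound l0)[c [N [c0 wc]]].
have [B [M [B0 uB]]] := quartic_lower_bound (g_rlap (leq0n 2))
  (g_rlap (isT : (1 <= 2)%N)) c0 wc.
exact: liminf_gt0 B0 uB.
Qed.

Lemma zero_limit_bounds : lim_at_infty (lapn 2 u) 0%:E ->
  (forall x, lapn 2 u x < 0) /\ (forall x, 0 < lapn 1 u x) /\
  exists C : R, 0 < C /\ exists M : R, forall x,
    M < enorm x -> u x <= C * enorm x ^+ 2.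
Proof.
move=> /lapn2_neg w0.
have g01 := g_rlap (leq0n 2); have g12 := g_rlap (isT : (1 <= 2)%N).
split=> [x|]; first by rewrite g_radial // w0 // enorm_ge0.
split=> [x|].
  by rewrite g_radial //; apply: (v_gt0 g_gt0 g01 g12) => //; exact: enorm_ge0.
have [C [M [C0 uC]]] := quadratic_upper_bound g01 g12 w0.
by exists C; split=> //; exists M => x /uC; rewrite u_profile.
Qed.

End RadialSolution.

Theorem mainTheorem12 (R : realType) :
  (* (i) *)
  (forall (n : nat) (q : R) (u : 'rV[R]_n -> R),
     (3 <= n)%N -> n <> 4%N -> n <> 6%N -> 1 / 2 < q ->
     pos_radial_sol q u ->
     (0 < liminf_at_infty (fun x => (u x / enorm x ^+ 4)%R))%E ->
     limit_formula u)
  /\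
  (* (ii) *)
  (forall (n : nat) (q : R) (u : 'rV[R]_n -> R),
     (2 <= n)%N -> 0 < q -> pos_radial_sol q u ->
     (* (a) *)
     (forall l : \bar R, (0 < l)%E -> lim_at_infty (lapn 2 u) l ->
        (0 < liminf_at_infty (fun x => (u x / enorm x ^+ 4)%R))%E /\
        ((3 <= n)%N -> n <> 4%N -> n <> 6%N -> 1 / 2 < q -> limit_formula u))
     /\
     (* (b) *)
     (lim_at_infty (lapn 2 u) 0%:E ->
        (forall x, lapn 2 u x < 0) /\ (forall x, 0 < lapn 1 u x) /\
        exists C : R, 0 < C /\ exists M : R, forall x,
          M < enorm x -> u x <= C * enorm x ^+ 2)).
Proof.
(* Isolated because (ii)(a) also ends with it, once the liminf is known to be positive. *)
have partI (n : nat) (q : R) (u : 'rV[R]_n -> R) : (3 <= n)%N -> 1 / 2 < q ->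
    pos_radial_sol q u ->
    (0 < liminf_at_infty (fun x => (u x / enorm x ^+ 4)%R))%E -> limit_formula u.
  case: n u => [|[|[|m]]] // u _ q2 usol /liminf_gt0_bound[c [N [c0 cu]]].
  exact (quartic_limit_formula usol isT q2 c0 cu).
split=> [n q u n3 _ _|[|[|m]] // q u _ q0 usol]; first exact: partI.
split=> [l l0 ul|]; last exact: zero_limit_bounds usol.
have inf0 := quartic_liminf usol l0 ul.
by split=> // n3 _ _ q2; exact: partI usol inf0.
Qed.
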